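(* For all integers $n\ge 0$ and $s\ge1$, $$x_s^{\underline{\underline{n}}}=\sum_{k=0}^{n}\overline{\left\lceil\!\!\left\lceil\begin{matrix} n\\ k\end{matrix}\right\rceil\!\!\right\rceil}_{s}\,x_s^{\overline{\overline{k}}},$$ where $\overline{\left\lceil\!\!\left\lceil\begin{matrix} n\\ k\end{matrix}\right\rceil\!\!\right\rceil}_{s}=(-1)^{n+k}\left\lceil\!\!\left\lceil\begin{matrix} n\\ k\end{matrix}\right\rceil\!\!\right\rceil_{s}$ are the signed Lah numbers of order $s$.
   Context: For integers $n\ge0$, $s\ge1$, the rising and falling factorials with higher level are the polynomials $x_s^{\overline{\overline{n}}}=\prod_{i=0}^{n-1}(x+i^s)$ and $x_s^{\underline{\underline{n}}}=\prod_{i=0}^{n-1}(x-i^s)$, with $x_s^{\overline{\overline{0}}}=x_s^{\underline{\underline{0}}}=1$. For a partition $\pi=\{b_1,\dots,b_k\}$ of $[n]=\{1,\dots,n\}$ into non-empty blocks, $\operatorname{bl}\pi=\{\min b_1,\dots,\min b_k\}$. For $s\ge1$, the Stirling number of the first kind with higher level, $\left[\!\left[\begin{matrix} n\\ k\end{matrix}\right]\!\right]_{s}$ (resp. of the second kind, $\left\{\!\left\{\begin{matrix} n\\ k\end{matrix}\right\}\!\right\}_{s}$), is the number of ordered $s$-tuples $(\pi_1,\dots,\pi_s)$ of partitions of $[n]$ into $k$ non-empty cyclically ordered blocks (resp. $k$ non-empty unordered blocks) with $\operatorname{bl}\pi_1=\dots=\operatorname{bl}\pi_s$. Equivalently (known),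 they are determined for $n,k\ge1$ by $\left[\!\left[\begin{matrix} n\\ k\end{matrix}\right]\!\right]_{s}=\left[\!\left[\begin{matrix} n-1\\ k-1\end{matrix}\right]\!\right]_{s}+(n-1)^s\left[\!\left[\begin{matrix} n-1\\ k\end{matrix}\right]\!\right]_{s}$ and $\left\{\!\left\{\begin{matrix} n\\ k\end{matrix}\right\}\!\right\}_{s}=\left\{\!\left\{\begin{matrix} n-1\\ k-1\end{matrix}\right\}\!\right\}_{s}+k^s\left\{\!\left\{\begin{matrix} n-1\\ k\end{matrix}\right\}\!\right\}_{s}$, both being $1$ at $(n,k)=(0,0)$ and $0$ at $(n,0)$ and $(0,n)$ for $n>0$. The Lah numbers of order $s$ are defined for integers $n,k\ge0$, $s\ge1$ by $$\left\lceil\!\!\left\lceil\begin{matrix} n\\ k\end{matrix}\right\rceil\!\!\right\rceil_{s}=\sum_{j=k}^{n}\left[\!\left[\begin{matrix} n\\ j\end{matrix}\right]\!\right]_{s}\left\{\!\left\{\begin{matrix} j\\ k\end{matrix}\right\}\!\right\}_{s},$$ and are $0$ for $n<k$. *)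

(* Defs.v *)
From HB Require Import structures.
From mathcomp Require Import all_boot all_order all_fingroup all_algebra.

Set Implicit Arguments.
Unset Strict Implicit.
Unset Printing Implicit Defensive.

Import GRing.Theory.
Local Open Scope ring_scope.

(* The set [n] = {1, ..., n} is represented by 'I_n = {0, ..., n - 1}: the     *)
(* notions below depend only on the order of the elements, not their labels.  *)

Definition bl (n : nat) (P : {set {set 'I_n}}) : {set 'I_n} :=
  [set x | [exists B in P, (x \in B) && [forall y in B, (x <= y)%N]]].

(* A partition of [n] into cyclically ordered blocks is a permutation of [n]: *)
(* the blocks are its cycles (fixed points included), each one cyclically     *)
(* ordered by the action of the permutation.                                  *)
Definition stirling1 (s n k : nat) : nat :=
  #|[set t : {ffun 'I_s -> {perm 'I_n}} |
      [forall i, #|porbits (t i)| == k] &&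
      [forall i, forall j, bl (porbits (t i)) == bl (porbits (t j))]]|.

Definition stirling2 (s n k : nat) : nat :=
  #|[set t : {ffun 'I_s -> {set {set 'I_n}}} |
      [forall i, partition (t i) [set: 'I_n] && (#|t i| == k)] &&
      [forall i, forall j, bl (t i) == bl (t j)]]|.

Definition lah (s n k : nat) : nat :=
  (\sum_(k <= j < n.+1) stirling1 s n j * stirling2 s j k)%N.

Definition signed_lah (s n k : nat) : int :=
  (-1) ^+ (n + k) * (lah s n k)%:Z.

Definition rising_fact (s n : nat) : {poly int} :=
  \prod_(i < n) ('X + ((i ^ s)%N%:Z)%:P).

Definition falling_fact (s n : nat) : {poly int} :=
  \prod_(i < n) ('X - ((i ^ s)%N%:Z)%:P).

(* Main.v *)
Require Import Defs.
From mathcomp Require Import all_boot all_order all_fingroup all_algebra.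

Import GRing.Theory.
Local Open Scope ring_scope.

(** The proof passes through monomials:
    falling_fact s n  =  sum_j (-1)^(n+j) [[n, j]]_s X^j    and
    X^j  =  sum_k (-1)^(j+k) {{j, k}}_s rising_fact s k;
    substituting the second expansion into the first, the signs combine to
    (-1)^(n+k) and the coefficients to the Lah numbers.

    Both expansions are read off a weighted sum over subsets M of 'I_n, where M
    is the common set of block minima.  An s-tuple of structures which share
    their minima is a choice of M followed by s independent choices of a
    structure with minima M ([card_concordant_ffun]), so a Stirling number of
    level s is the sum over the k-subsets M of a(M)^s, a(M) being the number of
    single structures with minima M.  This number is a product over the
    elements which are not minima:
    - for permutations, a(M) is the product of the i outside M
      ([card_perm_bl]): building a permutation by inserting 0, 1, 2, ... in
      turn, i either opens a new cycle, of which it stays the minimum, or is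
      put right after one of the i smaller elements;
    - for set partitions, a(M) is the product over i outside M of the number of
      m in M below i ([card_partition_bl]): a partition amounts to the map that
      sends each element to the minimum of its block.

    The s-th power of a(M) distributes over these products.  The first
    expansion is then the expansion of the product of the factors X - i^s, M
    being the set of the factors that contribute X ([falling_fact_sum_set]).
    The second one is an induction on the exponent, in which the two ways to
    extend M from 'I_n to 'I_n.+1 match the two terms of
    X r_k = r_(k+1) - k^s r_k, where r_k is the k-th rising factorial
    ([exprX_sum_set]). *)

(** * Tuples of structures with a common set of block minima *)

(** The common value M of [b] along the tuple is fixed first; then the entries
    are independent.  A tuple has a well-defined common value because s > 0. *)
Lemma card_concordant_ffun (T U : finType) (Q : pred T) (b : T -> U) (s : nat) :
    (0 < s)%N ->
  #|[set t : {ffun 'I_s -> T} |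
      [forall i, Q (t i)] && [forall i, forall j, b (t i) == b (t j)]]|
  = (\sum_(M : U) #|[set x | Q x && (b x == M)]| ^ s)%N.
Proof.
case: s => // s _; rewrite -sum1_card.
rewrite (partition_big (fun t : {ffun _} => b (t ord0)) xpredT) //=.
apply: eq_bigr => M _; rewrite -[in RHS](card_ord s.+1) -card_ffun_on -sum1_card.
apply: eq_bigl => t; rewrite inE; apply/andP/ffun_onP => [[] | tM].
  case/andP=> /forallP Qt /forallP bt /eqP <- i; rewrite inE Qt /=.
  by have /forallP/(_ ord0) := bt i.
have {}tM i : Q (t i) /\ b (t i) = M.
  by have:= tM i; rewrite inE => /andP[? /eqP].
split; last by rewrite (tM ord0).2.
apply/andP; split; first by apply/forallP => i; have [] := tM i.
by apply/forallP=> i; apply/forallP=> j; rewrite (tM i).2 (tM j).2.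
Qed.

Lemma mem_bl_preim_partition (n : nat) (T : eqType) (f : 'I_n -> T) (x : 'I_n) :
  (x \in bl (preim_partition f [set: 'I_n]))
    = [forall y, (f y == f x) ==> (x <= y)%N].
Proof.
rewrite inE; apply/exists_inP/forallP => [[B /imsetP[z _ ->]] | xmin].
  rewrite !inE /= => /andP[/eqP fzx /forall_inP xmin] y.
  by apply/implyP=> /eqP fyx; apply: xmin; rewrite !inE /= fyx fzx.
exists [set y in [set: 'I_n] | f x == f y].
  by apply/imsetP; exists x.
rewrite !inE eqxx /=; apply/forall_inP=> y; rewrite !inE /= eq_sym.
by apply/implyP/xmin.
Qed.

(** [bl P] is a transversal of P: it meets each block exactly in its minimum. *)
Lemma card_bl (n : nat) (P : {set {set 'I_n}}) :
  partition P [set: 'I_n] -> #|bl P| = #|P|.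
Proof.
move=> partP; apply: (@card_transversal _ _ _ setT).
rewrite /is_transversal partP subsetT /=; apply/forall_inP=> B PB.
have [x0 Bx0] : exists x, x \in B.
  by apply/set0Pn; apply: contraTneq PB => ->; have/and3P[] := partP.
have [x Bx xmin] := arg_minnP (fun y : 'I_n => y : nat) Bx0.
rewrite (_ : bl P :&: B = [set x]) ?cards1 //; apply/setP=> y; rewrite !inE.
apply/andP/eqP => [[/exists_inP[C PC /andP[Cy /forall_inP ymin]] By] | ->].
  have eqBC : B = C.
    have /and3P[_ tiP _] := partP.
    by rewrite -(def_pblock tiP PB By) (def_pblock tiP PC Cy).
  by apply/val_inj/eqP; rewrite eqn_leq /= xmin // ymin // -eqBC.
split=> //; apply/exists_inP; exists B => //.
by apply/andP; split; last exact/forall_inP.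
Qed.

(** * Permutations with given cycle minima *)

(** Seeing the cycles as the fibres of [porbit p] gives access to
    [mem_bl_preim_partition], and to [card_bl] by way of [preim_partitionP]. *)
Lemma porbits_preim_partition (T : finType) (p : {perm T}) :
  porbits p = preim_partition (porbit p) setT.
Proof.
have orbE x : porbit p x = [set y in setT | porbit p x == porbit p y].
  by apply/setP=> y; rewrite !inE /= eq_sym eq_porbit_mem.
by apply/setP=> B; apply/imsetP/imsetP=> -[x _ ->]; exists x; rewrite ?inE.
Qed.

Lemma partition_porbits (T : finType) (p : {perm T}) :
  partition (porbits p) [set: T].
Proof. by rewrite porbits_preim_partition preim_partitionP. Qed.

Lemma mem_bl_porbits (n : nat) (p : {perm 'I_n}) (x : 'I_n) :
  (x \in bl (porbits p)) = [forall y in porbit p x, (x <= y)%N].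
Proof.
rewrite porbits_preim_partition mem_bl_preim_partition.
by apply: eq_forallb => y; rewrite eq_porbit_mem.
Qed.

(** As permutations compose from left to right, this maps j to the new element
    [ord_max], and [ord_max] to the former image of j: [ord_max] is inserted
    right after j in its cycle.  The choice j = [ord_max] makes it a new fixed
    point. *)
Definition insert_max {n : nat} (q : {perm 'I_n} * 'I_n.+1) : {perm 'I_n.+1} :=
  (tperm ord_max q.2 * lift_perm ord_max ord_max q.1)%g.

(** Injectivity suffices, as both sides have (n + 1)! elements; j is recovered
    as the preimage of [ord_max]. *)
Lemma insert_max_bij (n : nat) : bijective (@insert_max n).
Proof.
apply: inj_card_bij; last first.
  by rewrite card_prod !card_Sn card_ord factS mulnC.
move=> [q j] [q' j'] /= eq_ins.
have eq_j: j = j'.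
  apply: (@perm_inj _ (insert_max (q, j))); rewrite [in RHS]eq_ins.
  by rewrite !permM !tpermR !lift_perm_id.
move: eq_ins; rewrite /insert_max /= eq_j => /mulgI eq_lift.
congr (_, _); apply/permP=> x; apply: (@lift_inj _ ord_max).
by rewrite -!(lift_perm_lift ord_max) eq_lift.
Qed.

Lemma insert_max_lift (n : nat) (q : {perm 'I_n}) (j : 'I_n.+1) (x : 'I_n) :
  insert_max (q, j) (lift ord_max x)
    = if lift ord_max x == j then ord_max else lift ord_max (q x).
Proof.
rewrite permM /=; case: eqP => [<- | /eqP jx]; first by rewrite tpermR lift_perm_id.
by rewrite tpermD ?lift_perm_lift ?eq_liftF // eq_sym.
Qed.

Lemma insert_max_ord_max (n : nat) (q : {perm 'I_n}) (j : 'I_n.+1) (x : 'I_n) :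
  lift ord_max x = j -> insert_max (q, j) ord_max = lift ord_max (q x).
Proof. by move=> xj; rewrite permM /= tpermL -xj lift_perm_lift. Qed.

(** Inserting [ord_max] only lengthens a cycle: erasing it from the cycles of
    [insert_max (q, j)] gives back those of q. *)
Lemma porbit_insert_max (n : nat) (q : {perm 'I_n}) (j : 'I_n.+1) (x y : 'I_n) :
  (lift ord_max y \in porbit (insert_max (q, j)) (lift ord_max x))
    = (y \in porbit q x).
Proof.
set p := insert_max (q, j); apply/porbitP/porbitP=> -[k].
  (* Along its orbit under p, the point is either a lifted point of the q-orbit
     of x, or [ord_max], in which case j lies in that q-orbit. *)
  suff: (exists2 z, (p ^+ k)%g (lift ord_max x) = lift ord_max z
                    & z \in porbit q x) \/
        ((p ^+ k)%g (lift ord_max x) = ord_max /\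
         exists2 z, lift ord_max z = j & z \in porbit q x).
    case=> [[z -> qz] /lift_inj -> | [->] _ /eqP]; first exact/porbitP.
    by rewrite eq_sym eq_liftF.
  elim: k => [|k IHk].
    by left; exists x; rewrite ?expg0 ?perm1 ?porbit_id.
  rewrite expgSr permM; case: IHk => [[z -> qz] | [-> [z zj qz]]].
    rewrite insert_max_lift; case: eqP => [zj | _].
      by right; split=> //; exists z.
    left; exists (q z) => //.
    by rewrite -eq_porbit_mem (porbit_perm q 1) eq_porbit_mem.
  left; exists (q z); first exact: insert_max_ord_max.
  by rewrite -eq_porbit_mem (porbit_perm q 1) eq_porbit_mem.
move=> ->; apply/porbitP; elim: k => [|k IHk].
  by rewrite expg0 perm1 porbit_id.
rewrite expgSr permM; set z := (q ^+ k)%g x in IHk *.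
move: IHk; rewrite -!eq_porbit_mem => /eqP <-; rewrite eq_porbit_mem porbit_sym.
(* One step of q is one step of p, or two steps when it passes [ord_max]. *)
have [zj | zNj] := eqVneq (lift ord_max z) j.
  have -> : lift ord_max (q z) = (p ^+ 2)%g (lift ord_max z).
    rewrite expgS expg1 permM insert_max_lift zj eqxx.
    exact/esym/insert_max_ord_max.
  by rewrite porbit_sym mem_porbit.
have -> : lift ord_max (q z) = (p ^+ 1)%g (lift ord_max z).
  by rewrite expg1 insert_max_lift (negPf zNj).
by rewrite porbit_sym mem_porbit.
Qed.

(** The new element is larger than all the others, so it never takes over as
    the minimum of a cycle, and it is a minimum only of a cycle of its own. *)
Lemma bl_insert_max (n : nat) (q : {perm 'I_n}) (j : 'I_n.+1) (M : {set 'I_n.+1}) :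
  (bl (porbits (insert_max (q, j))) == M)
    = (bl (porbits q) == [set x | lift ord_max x \in M])
      && ((j == ord_max) == (ord_max \in M)).
Proof.
set p := insert_max (q, j).
have lift_bl x : (lift ord_max x \in bl (porbits p)) = (x \in bl (porbits q)).
  rewrite !mem_bl_porbits; apply/forall_inP/forall_inP => xmin y xy.
    have := xmin (lift ord_max y); rewrite !lift_max; apply.
    by rewrite porbit_insert_max.
  have [y' yE | ->] := unliftP ord_max y; last by rewrite -ltnS ltn_ord.
  by rewrite yE !lift_max xmin // -(porbit_insert_max n q j) -yE.
have max_bl : (ord_max \in bl (porbits p)) = (j == ord_max).
  rewrite mem_bl_porbits; apply/forall_inP/eqP => [maxmin | jmax y].
    have [j' jE | //] := unliftP ord_max j.
    have := maxmin _ (mem_porbit p 1 ord_max).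
    by rewrite expg1 (insert_max_ord_max n q j j') // lift_max leqNgt ltn_ord.
  case/porbitP=> k ->; rewrite permX_fix //.
  by rewrite permM /= jmax tperm1 perm1 lift_perm_id.
apply/eqP/andP=> [<- | [/eqP bl_q /eqP j_max]].
  by rewrite max_bl eqxx; split=> //; apply/eqP/setP=> x; rewrite -lift_bl [RHS]inE.
apply/setP=> x; have [x' -> | ->] := unliftP ord_max x.
  by rewrite lift_bl bl_q inE.
by rewrite max_bl.
Qed.

(** By [bl_insert_max], the last of n + 1 elements has one admissible position
    if it is in M, and n otherwise. *)
Lemma card_perm_bl (n : nat) (M : {set 'I_n}) :
  #|[set p : {perm 'I_n} | bl (porbits p) == M]| = (\prod_(i | i \notin M) i)%N.
Proof.
elim: n M => [|n IHn] M.
  rewrite big_pred0 => [|[]//]; rewrite (_ : [set _ | _] = setT) ?cardsT ?card_Sn //.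
  by apply/setP=> p; rewrite !inE; apply/eqP/setP; case.
rewrite -sum1_card (reindex _ (onW_bij _ (insert_max_bij n))) /=.
pose M0 := [set x | lift ord_max x \in M].
pose J := [set j : 'I_n.+1 | (j == ord_max) == (ord_max \in M)].
transitivity #|setX [set q : {perm 'I_n} | bl (porbits q) == M0] J|.
  rewrite -sum1_card; apply: eq_bigl => -[q j].
  by rewrite !inE bl_insert_max.
rewrite cardsX IHn [RHS]big_mkcond (bigD1_ord ord_max) //= mulnC -big_mkcond /=.
congr (_ * _)%N; last first.
  by apply: eq_big => [x | x _]; rewrite ?inE //; apply/esym/lift_max.
have [Mmax | Mmax] /= := boolP (ord_max \in M).
  by rewrite -(cards1 (@ord_max n)); apply: eq_card => j; rewrite !inE Mmax eqb_id.
transitivity #|[set~ @ord_max n]|; last by rewrite cardsC1 card_ord.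
by apply: eq_card => j; rewrite !inE (negPf Mmax) eqbF_neg.
Qed.

(** * Set partitions with given block minima *)

(** A partition with minima M is the partition into the fibres of a unique map
    f which fixes M and sends every other i to an element of M below i: f maps
    each element to the minimum of its block.  The choices of f i are
    independent, whence the product. *)
Lemma card_partition_bl (n : nat) (M : {set 'I_n}) :
  #|[set P | partition P [set: 'I_n] && (bl P == M)]|
    = (\prod_(i | i \notin M) #|[set m in M | m < i]|)%N.
Proof.
pose F (i : 'I_n) := [pred m | if i \in M then m == i else (m \in M) && (m < i)%N].
transitivity #|(family F : simpl_pred {ffun 'I_n -> 'I_n})|; last first.
  rewrite card_family foldrE big_image [RHS]big_mkcond; apply: eq_bigr => i _.
  have [Mi | nMi] /= := boolP (i \in M).
    by rewrite -(card1 i); apply: eq_card => m; rewrite !inE Mi.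
  by apply: eq_card => m; rewrite !inE (negPf nMi).
have FM (f : {ffun 'I_n -> 'I_n}) : f \in family F ->
  [/\ forall x, f x \in M, {in M, forall x, f x = x} & forall x, (f x <= x)%N].
  move=> /familyP fF; split=> x; have := fF x; rewrite !inE.
  - by case: ifP => [Mx /eqP-> | _ /andP[]].
  - by move=> + Mx; rewrite Mx => /eqP.
  by case: ifP => [_ /eqP-> | _ /andP[_ /ltnW]].
pose part (f : {ffun 'I_n -> 'I_n}) := preim_partition f [set: 'I_n].
(* f is determined by its fibres: x and f x lie in the same fibre, hence also
   for any g with the same fibres, so that g x = g (f x) = f x. *)
rewrite -(card_in_imset (f := part) (D := family F)); last first.
  move=> f g /FM[fM fid _] /FM[gM gid _] eq_fg; apply/ffunP=> x.
  have eq_ker (h : {ffun 'I_n -> 'I_n}) y : (y \in pblock (part h) x) = (h x == h y).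
    apply: pblock_equivalence_partition; rewrite ?inE // => ? ? ? _ _ _.
    by split=> // /eqP->.
  have: f x \in pblock (part g) x by rewrite -eq_fg eq_ker (fid (f x)).
  by rewrite eq_ker (gid (f x)) // => /eqP.
apply: eq_card => P; rewrite inE; apply/andP/imsetP => [[partP /eqP blP] | [f fF ->]].
  pose g := pblock P.
  have gP : preim_partition g [set: 'I_n] = P by exact: preim_partition_pblock.
  pose f := [ffun x : 'I_n => [arg min_(y < x | g y == g x) (y : nat)]].
  have gf x : g (f x) = g x by rewrite ffunE; case: arg_minnP => // y /eqP.
  have fmin x y : g y = g x -> (f x <= y)%N.
    by move=> gyx; rewrite ffunE; case: arg_minnP => // z _; apply; apply/eqP.
  have memM x : (x \in M) = [forall y, (g y == g x) ==> (x <= y)%N].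
    by rewrite -blP -gP mem_bl_preim_partition.
  have fM x : f x \in M.
    by rewrite memM; apply/forallP=> y; apply/implyP; rewrite gf => /eqP /fmin.
  exists f.
    apply/familyP=> x; rewrite inE; case: ifPn => [| nMx].
      rewrite memM => /forallP/(_ (f x)); rewrite gf eqxx /= => x_le.
      by apply/eqP/val_inj/eqP; rewrite eqn_leq x_le fmin.
    by rewrite fM ltn_neqAle fmin // andbT; apply: contraNneq nMx => /val_inj <-.
  rewrite -gP; apply: eq_imset => x; apply/setP=> y; rewrite !inE /=.
  apply/eqP/eqP => [gxy | fxy]; last by rewrite -(gf x) fxy gf.
  by apply/val_inj/eqP; rewrite eqn_leq !fmin // gf.
(* Conversely, x is the minimum of its fibre under f exactly when f x = x. *)
have [fM fid fle] := FM f fF; split; first exact: preim_partitionP.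
apply/eqP/setP=> x; rewrite mem_bl_preim_partition; apply/forallP/idP => [xmin | Mx y].
  suff <- : f x = x by [].
  apply/val_inj/eqP; rewrite eqn_leq fle /=.
  by have /implyP := xmin (f x); rewrite fid //; apply.
by apply/implyP=> /eqP; rewrite (fid x) // => <-.
Qed.

(** * Stirling numbers as sums over sets of minima *)

(** A permutation with cycle minima M has #|M| cycles, so the condition on the
    number of cycles only restricts the size of M; the sets of another size
    contribute 0 ^ s = 0. *)
Lemma stirling1E (s n k : nat) : (0 < s)%N ->
  stirling1 s n k
    = (\sum_(M : {set 'I_n} | #|M| == k) (\prod_(i | i \notin M) i) ^ s)%N.
Proof.
move=> s_gt0; rewrite /stirling1 (card_concordant_ffun _ _
  (fun p : {perm 'I_n} => #|porbits p| == k) (fun p => bl (porbits p))) //.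
rewrite [RHS]big_mkcond; apply: eq_bigr => M _; rewrite -card_perm_bl.
have cardM (p : {perm 'I_n}) : bl (porbits p) == M -> #|porbits p| = #|M|.
  by move/eqP <-; rewrite card_bl ?partition_porbits.
case: ifP => [cM | cMN].
  congr (_ ^ _)%N; apply: eq_card => p; rewrite !inE andbC.
  by case: eqP => //= /eqP/cardM->.
rewrite (_ : [set _ | _] = set0) ?cards0 ?exp0n //; apply/setP=> p; rewrite !inE andbC.
by case: eqP => //= /eqP/cardM->.
Qed.

Lemma stirling2E (s n k : nat) : (0 < s)%N ->
  stirling2 s n k
    = (\sum_(M : {set 'I_n} | #|M| == k)
         (\prod_(i | i \notin M) #|[set m in M | m < i]|) ^ s)%N.
Proof.
move=> s_gt0; rewrite /stirling2 (card_concordant_ffun _ _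
  (fun P => partition P [set: 'I_n] && (#|P| == k)) (@bl n)) //.
rewrite [RHS]big_mkcond; apply: eq_bigr => M _; rewrite -card_partition_bl.
have cardM P : partition P [set: 'I_n] -> bl P == M -> #|P| = #|M|.
  by move=> partP /eqP <-; rewrite card_bl.
case: ifP => [cM | cMN].
  congr (_ ^ _)%N; apply: eq_card => P; rewrite !inE.
  have [partP | //] := boolP (partition P _).
  by case: (eqVneq (bl P) M) => [/eqP/(cardM P partP)-> | _]; rewrite ?cM ?andbF.
rewrite (_ : [set _ | _] = set0) ?cards0 ?exp0n //; apply/setP=> P; rewrite !inE.
have [partP | //] := boolP (partition P _).
by case: (eqVneq (bl P) M) => [/eqP/(cardM P partP)-> | _]; rewrite ?cMN ?andbF.
Qed.

(** Turns a signed expansion over subsets, with weight w, into one over sizes,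
    in the form in which the Stirling numbers appear as coefficients. *)
Lemma sum_by_card (n : nat) (w : {set 'I_n} -> nat) (G : nat -> {poly int}) :
  \sum_(0 <= k < n.+1)
     ((-1) ^+ (n + k) * (\sum_(M : {set 'I_n} | #|M| == k) w M)%N%:Z) *: G k
  = \sum_(M : {set 'I_n}) ((-1) ^+ (n + #|M|) * (w M)%:Z) *: G #|M|.
Proof.
have leM (M : {set 'I_n}) : (#|M| < n.+1)%N.
  by rewrite ltnS -[leqRHS]card_ord max_card.
rewrite big_mkord (partition_big (fun M : {set 'I_n} => Ordinal (leM M)) xpredT) //=.
apply: eq_bigr => k _; rewrite -natz natr_sum mulr_sumr scaler_suml.
apply: eq_big => M; first by rewrite -val_eqE.
by move/eqP->; rewrite natz.
Qed.

(** * The two expansions *)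

(** M is the set of the factors X - i^s from which X is picked; the sign is
    (-1)^(n - #|M|), written with a sum to avoid truncated subtraction. *)
Lemma falling_fact_sum_set (s n : nat) :
  falling_fact s n = \sum_(M : {set 'I_n})
    ((-1) ^+ (n + #|M|) * ((\prod_(i | i \notin M) i) ^ s)%N%:Z) *: 'X^#|M|.
Proof.
rewrite /falling_fact bigA_distr; apply: eq_big => // M _.
rewrite (bigID (mem M)) /= mulrC.
rewrite (eq_bigr (fun i : 'I_n => - ((i ^ s)%N%:Z)%:P)) => [|i /negPf->] //.
rewrite [X in _ * X](eq_bigr (fun=> 'X)) => [|i ->] //; rewrite prodr_const.
rewrite -mul_polyC; congr (_ * _).
rewrite prodrN -rmorph_prod polyCM polyC_exp polyCN.
congr (_ * _).
  have /esym nE : (#|M| + #|[predC M]|)%N = n by rewrite cardC card_ord.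
  rewrite [X in (X + _)%N]nE addnAC polyC1 exprD addnn -mul2n exprM.
  by rewrite sqrrN !expr1n mul1r.
congr _%:P; rewrite -natz natrX natr_prod -prodrXl.
by apply: eq_bigr => i _; rewrite -natrX natz.
Qed.

Definition extend_set {n : nat} (N : {set 'I_n} * bool) : {set 'I_n.+1} :=
  [set x | if unlift ord_max x is Some y then y \in N.1 else N.2].

Lemma extend_set_bij (n : nat) : bijective (@extend_set n).
Proof.
exists (fun M : {set 'I_n.+1} =>
          ([set x : 'I_n | lift ord_max x \in M], ord_max \in M)) => [[N b] | M].
  by rewrite inE unlift_none; congr (_, _); apply/setP=> x; rewrite !inE liftK.
by apply/setP=> x; rewrite !inE /=; case: unliftP => [y|] ->; rewrite ?inE.
Qed.

Lemma card_extend_set (n : nat) (N : {set 'I_n}) (b : bool) :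
  #|extend_set (N, b)| = (#|N| + b)%N.
Proof.
rewrite -!sum1_card big_mkcond (bigD1_ord ord_max) //= inE unlift_none.
rewrite -big_mkcond [RHS]addnC; congr (_ + _)%N.
by apply: eq_bigl => x; rewrite inE liftK.
Qed.

(** A new last element changes no count below an old one; if it is outside the
    set, it contributes its own factor, the size of the set. *)
Lemma prod_below_extend_set (n : nat) (N : {set 'I_n}) (b : bool) :
  (\prod_(i | i \notin extend_set (N, b)) #|[set m in extend_set (N, b) | m < i]|
   = (\prod_(i | i \notin N) #|[set m in N | m < i]|) * #|N| ^ (~~ b))%N.
Proof.
have below (i : 'I_n.+1) : #|[set m in extend_set (N, b) | (m < i)%N]|
    = #|[set m in N | (m < i)%N]|.
  rewrite -!sum1_card big_mkcond (bigD1_ord ord_max) //=.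
  rewrite !inE ltnNge -ltnS ltn_ord andbF add0n -big_mkcond.
  by apply: eq_bigl => x; rewrite !inE liftK lift_max.
rewrite big_mkcond (bigD1_ord ord_max) //= mulnC -big_mkcond /=.
congr (_ * _)%N.
  apply: eq_big => [x | x _]; first by rewrite inE liftK.
  by rewrite (below (lift ord_max x)) lift_max.
rewrite inE unlift_none (below ord_max) /=; case: (b) => //=; rewrite expn1.
by apply: eq_card => x; rewrite !inE ltn_ord andbT.
Qed.

(** In the induction step, the terms of N with and without [ord_max] add up to
    w (r_(k+1) - k^s r_k) = w X r_k, where k = #|N|, r_k = [rising_fact s k]
    and w is the signed weight of N. *)
Lemma exprX_sum_set (s n : nat) :
  'X^n = \sum_(M : {set 'I_n})
    ((-1) ^+ (n + #|M|)
      * ((\prod_(i | i \notin M) #|[set m in M | m < i]|) ^ s)%N%:Z)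
    *: rising_fact s #|M|.
Proof.
elim: n => [|n IHn].
  rewrite (big_pred1 set0) => [|M]; last by apply/esym/eqP/setP; case.
  by rewrite cards0 /rising_fact big_ord0 big_pred0 ?exp1n ?mul1r ?scale1r // => -[].
rewrite (reindex _ (onW_bij _ (extend_set_bij n))) /=.
rewrite -(pair_bigA _ (fun N b => ((-1) ^+ (n.+1 + #|extend_set (N, b)|)
      * ((\prod_(i | i \notin extend_set (N, b))
            #|[set m in extend_set (N, b) | m < i]|) ^ s)%N%:Z)
    *: rising_fact s #|extend_set (N, b)|)) /=.
rewrite exprSr [in LHS]IHn mulr_suml; apply: eq_bigr => N _.
rewrite big_bool !card_extend_set !prod_below_extend_set /= addn0 addn1 muln1 expn1.
rewrite {2}/rising_fact big_ord_recr /= -/(rising_fact s #|N|).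
rewrite addnS addSn !exprS !mulN1r opprK expnMn PoszM mulrDr scalerDr -scalerAl.
by rewrite [_ * _%:P]mulrC mul_polyC scalerA mulNr scaleNr mulrA addrK.
Qed.

Theorem theorem3p7 (n s : nat) (hs : (1 <= s)%N) :
  falling_fact s n = \sum_(0 <= k < n.+1) signed_lah s n k *: rising_fact s k.
Proof.
have fallE : falling_fact s n = \sum_(0 <= j < n.+1)
    ((-1) ^+ (n + j) * (stirling1 s n j)%:Z) *: 'X^j.
  rewrite falling_fact_sum_set -(sum_by_card _ _ (fun j => 'X^j)).
  by apply: eq_bigr => j _; rewrite stirling1E.
have powE j : 'X^j = \sum_(0 <= k < j.+1)
    ((-1) ^+ (j + k) * (stirling2 s j k)%:Z) *: rising_fact s k.
  rewrite (exprX_sum_set s) -sum_by_card.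
  by apply: eq_bigr => k _; rewrite stirling2E.
have lahE k : signed_lah s n k = \sum_(0 <= j < n.+1 | (k <= j)%N)
    ((-1) ^+ (n + j) * (stirling1 s n j)%:Z)
      * ((-1) ^+ (j + k) * (stirling2 s j k)%:Z).
  rewrite /signed_lah /lah -natz natr_sum mulr_sumr (big_nat_widenl _ 0) //.
  apply: eq_bigr => j _; rewrite mulrACA -exprD -natz natrM !natz; congr (_ * _).
  by rewrite addnA -(addnA n) addnn addnAC [RHS]exprD -mul2n exprM sqrrN !expr1n mulr1.
under [RHS]eq_bigr => k _ do rewrite lahE scaler_suml.
rewrite fallE (exchange_big_dep xpredT) //=; apply: eq_big_nat => j /andP[_ lt_jn].
rewrite powE scaler_sumr [LHS](big_nat_widen _ _ n.+1) //.
by apply: eq_bigr => k _; rewrite scalerA.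
Qed.
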